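(* Let $y:\mathbb{R}^n\to\mathbb{R}^m$ have vector relative degree $r=(r_1,\dots,r_m)$ on an open set $\mathcal{E}\supset\mathcal{S}$ for the system $\dot x=f(x)+g(x)u$, and suppose that $\alpha^i_1>0$ and $\overline{y}_i>\underline{y}_i$ for all $i\in\{1,\dots,m\}$. Let $k_{\rm d}:\mathbb{R}^n\to\mathbb{R}^m$ and $G:\mathbb{R}^n\to\mathbb{R}^{m\times m}$ be locally Lipschitz, with $G(x)$ symmetric positive definite for all $x$. Then for every $x\in\mathcal{E}$ the quadratic program $$\min_{u\in\mathbb{R}^m}\ \tfrac12(u-k_{\rm d}(x))^\top G(x)(u-k_{\rm d}(x))$$ subject to, for all $i\in\{1,\dots,m\}$, $$L_f^{r_i}\underline{h}_i(x)+L_gL_f^{r_i-1}\underline{h}_i(x)\,u\ \ge\ -\alpha_i^\top\underline{H}_i(x),\qquad L_f^{r_i}\overline{h}_i(x)+L_gL_f^{r_i-1}\overline{h}_i(x)\,u\ \ge\ -\alpha_i^\top\overline{H}_i(x),$$ has an optimal solution $u^*(x)$, this solution is unique, and the map $u^*:\mathcal{E}\to\mathbb{R}^m$ is locally Lipschitz continuous.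
   Context: System: $\dot x=f(x)+g(x)u$ with $x\in\mathbb{R}^n$, $u\in\mathbb{R}^m$, where $f:\mathbb{R}^n\to\mathbb{R}^n$ and $g:\mathbb{R}^n\to\mathbb{R}^{n\times m}$ are smooth (continuously differentiable as many times as necessary). The output $y=(y_1,\dots,y_m):\mathbb{R}^n\to\mathbb{R}^m$ is smooth. Lie derivatives: $L_fh(x)=\frac{\partial h}{\partial x}(x)f(x)$, $L_f^0h=h$, $L_f^ih=L_f(L_f^{i-1}h)$, and $L_gh(x)=\frac{\partial h}{\partial x}(x)g(x)\in\mathbb{R}^{1\times m}$. Vector relative degree: $y$ has vector relative degree $r=(r_1,\dots,r_m)$ (positive integers) at $x$ if for all $i$, $L_gL_f^jy_i(x)=0$ for all $j\in\{0,\dots,r_i-2\}$, and the decoupling matrix $B(x)\in\mathbb{R}^{m\times m}$, whose $i$-th row is $b_i(x)^\top:=L_gL_f^{r_i-1}y_i(x)$, is invertible. It has vector relative degree $r$ on a set if this holds at each point of the set (with the same $r$). Bounds and gains: $\underline{y}_i,\overline{y}_i\in\mathbb{R}$. For each $i$, $\alpha_i=(\alpha_1^i,\dots,\alpha_{r_i}^i)\in\mathbb{R}^{r_i}$ is such that $s^{r_i}+\alpha^i_{r_i}s^{r_i-1}+\dots+\alpha^i_2s+\alpha^i_1=\prod_{j=1}^{r_i}(s-\nu^i_j)$ with all $\nu^i_j$ real and negative. Barrier functions: $\underline{h}_i(x)=y_i(x)-\underline{y}_i$, $\overline{h}_i(x)=\overline{y}_i-y_i(x)$, $\underline{H}_i(x)=(\underline{h}_i(x),L_f\underline{h}_i(x),\dots,L_f^{r_i-1}\underline{h}_i(x))^\top$,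 and $\overline{H}_i(x)=(\overline{h}_i(x),L_f\overline{h}_i(x),\dots,L_f^{r_i-1}\overline{h}_i(x))^\top$. Safe set: for $h\in\{\underline{h}_i,\overline{h}_i\}$ define recursively $\psi_0=h$ and $\psi_j=L_f\psi_{j-1}-\nu^i_j\psi_{j-1}$ for $j=1,\dots,r_i-1$ (on $\mathcal{E}$, $L_f\psi_{j-1}$ equals the time derivative of $\psi_{j-1}$ along the system, for any input). Set $\underline{\mathcal{S}}_i=\bigcap_{j=0}^{r_i-1}\{x\in\mathbb{R}^n:\psi_j(x)\ge0\}$ for $h=\underline{h}_i$, and $\overline{\mathcal{S}}_i$ likewise for $h=\overline{h}_i$. Then $\mathcal{S}:=\bigcap_{i=1}^m(\underline{\mathcal{S}}_i\cap\overline{\mathcal{S}}_i)$. *)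

(* Defs.v *)
From HB Require Import structures.
From mathcomp Require Import all_boot all_order all_algebra.
From mathcomp Require Import all_classical all_reals all_analysis.

Set Implicit Arguments.
Unset Strict Implicit.
Unset Printing Implicit Defensive.

Import Order.TTheory GRing.Theory Num.Theory.
Import numFieldNormedType.Exports.

Local Open Scope classical_set_scope.
Local Open Scope ring_scope.

(* Indices are 0-based throughout: i : 'I_m stands for i + 1 in {1, ..., m},
   and likewise for the entries of alpha_i, nu^i and H_i. *)

Section Smoothness.
Context {R : realType} {n : nat}.
Implicit Types (h : 'cV[R]_n -> R).

Definition partial (j : 'I_n) h : 'cV[R]_n -> R :=
  fun x => 'D_(delta_mx j 0) h x.

Definition grad h (x : 'cV[R]_n) : 'rV[R]_n := \row_j partial j h x.

Fixpoint Ck (k : nat) h : Prop :=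
  if k is k'.+1 then
    (forall x, differentiable h x) /\ forall j, Ck k' (partial j h)
  else continuous h.

Definition Ck_mx (k p q : nat) (F : 'cV[R]_n -> 'M[R]_(p, q)) : Prop :=
  forall i j, Ck k (fun x => F x i j).

End Smoothness.

Section ControlAffine.
Context {R : realType} {n m : nat}.
Variables (f : 'cV[R]_n -> 'cV[R]_n) (g : 'cV[R]_n -> 'M[R]_(n, m)).
Implicit Types (h : 'cV[R]_n -> R) (x : 'cV[R]_n) (u : 'cV[R]_m).

Definition Lf h : 'cV[R]_n -> R := fun x => (grad h x *m f x) 0 0.

Definition Lf_iter (j : nat) h : 'cV[R]_n -> R := iter j Lf h.

Definition Lg h : 'cV[R]_n -> 'rV[R]_m := fun x => grad h x *m g x.

Definition output (y : 'cV[R]_n -> 'cV[R]_m) (i : 'I_m) : 'cV[R]_n -> R :=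
  fun x => y x i 0.

(* Relative degrees are positive; r i = 0 is junk because of (r i).-1. *)
Definition decoupling_matrix (y : 'cV[R]_n -> 'cV[R]_m) (r : 'I_m -> nat) x :
    'M[R]_m :=
  \matrix_(i < m) Lg (Lf_iter (r i).-1 (output y i)) x.

Definition vector_relative_degree_at
    (y : 'cV[R]_n -> 'cV[R]_m) (r : 'I_m -> nat) x : Prop :=
  (forall (i : 'I_m) (j : nat), (j.+1 < r i)%N ->
     Lg (Lf_iter j (output y i)) x = 0) /\
  decoupling_matrix y r x \in unitmx.

Definition vector_relative_degree_on
    (y : 'cV[R]_n -> 'cV[R]_m) (r : 'I_m -> nat) (E : set 'cV[R]_n) : Prop :=
  forall x, E x -> vector_relative_degree_at y r x.

Definition h_lower (y : 'cV[R]_n -> 'cV[R]_m) (ylo : 'I_m -> R) (i : 'I_m) :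
    'cV[R]_n -> R :=
  fun x => y x i 0 - ylo i.

Definition h_upper (y : 'cV[R]_n -> 'cV[R]_m) (yhi : 'I_m -> R) (i : 'I_m) :
    'cV[R]_n -> R :=
  fun x => yhi i - y x i 0.

Definition Hvec (r : nat) h x : 'cV[R]_r := \col_(j < r) Lf_iter j h x.

(* The recursion uses the roots in the order of the tuple; nu`_j' is the
   (j' + 1)-th root, and the last root does not enter barrier_set. *)
Fixpoint psi (nu : seq R) h (j : nat) : 'cV[R]_n -> R :=
  if j is j'.+1 then
    fun x => Lf (psi nu h j') x - nu`_j' * psi nu h j' x
  else h.

Definition barrier_set (r : nat) (nu : r.-tuple R) h : set 'cV[R]_n :=
  \bigcap_(j in `I_r) [set x | 0 <= psi nu h j x].

Definition safe_set (y : 'cV[R]_n -> 'cV[R]_m) (r : 'I_m -> nat)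
    (ylo yhi : 'I_m -> R) (nu : forall i, (r i).-tuple R) : set 'cV[R]_n :=
  \bigcap_(i in [set: 'I_m])
    (barrier_set (nu i) (h_lower y ylo i) `&`
     barrier_set (nu i) (h_upper y yhi i)).

Definition barrier_constraint (r : nat) (alpha : 'cV[R]_r) h x u : Prop :=
  - (alpha^T *m Hvec r h x) 0 0 <=
    Lf_iter r h x + (Lg (Lf_iter r.-1 h) x *m u) 0 0.

Definition qp_feasible (y : 'cV[R]_n -> 'cV[R]_m) (r : 'I_m -> nat)
    (ylo yhi : 'I_m -> R) (alpha : forall i, 'cV[R]_(r i)) x :
    set 'cV[R]_m :=
  [set u | forall i,
     barrier_constraint (alpha i) (h_lower y ylo i) x u /\
     barrier_constraint (alpha i) (h_upper y yhi i) x u].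

End ControlAffine.

Definition qp_cost {R : realType} {n m : nat} (kd : 'cV[R]_n -> 'cV[R]_m)
    (G : 'cV[R]_n -> 'M[R]_m) (x : 'cV[R]_n) (u : 'cV[R]_m) : R :=
  2^-1 * ((u - kd x)^T *m G x *m (u - kd x)) 0 0.

Definition minimizer {R : realType} {T : Type} (cost : T -> R) (A : set T)
    (u : T) : Prop :=
  A u /\ forall v, A v -> cost u <= cost v.

Definition sym_posdef {R : realType} {m : nat} (M : 'M[R]_m) : Prop :=
  M^T = M /\ forall v : 'cV[R]_m, v != 0 -> 0 < (v^T *m M *m v) 0 0.

(* Main.v *)
(* The relative degree makes the decoupling matrix B(x) invertible on E, and the
   two constraints of index i bound the i-th entry of B(x) u from below by some
   c_i(x) and from above by c_i(x) + d_i, where d_i = alpha^i_1 (yhi_i - ylo_i) > 0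
   is constant. In the coordinates v = B(x) u - c(x) the program is therefore a
   weighted projection onto the fixed box prod_i [0, d_i], with a weight Q(x) and
   a center p(x) that are locally Lipschitz in x. A minimizer exists by
   compactness. The variational inequalities of the minimizers at x and x', each
   tested against the other minimizer, give uniqueness (x = x') and bound
   (v - v')^T Q(x) (v - v') by |v - v'| |x - x'| up to a constant; and
   e_i^2 <= (Q(x)^-1)_ii e^T Q(x) e by Cauchy-Schwarz, where Q(x)^-1 is locally
   bounded. *)

Require Import Defs.
From HB Require Import structures.
From mathcomp Require Import all_boot all_order all_algebra.
From mathcomp Require Import all_classical all_reals all_analysis.
From mathcomp Require Import ring lra.
Import Order.TTheory GRing.Theory Num.Theory.
Import numFieldNormedType.Exports.
Local Open Scope classical_set_scope.
Local Open Scope ring_scope.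

Set Implicit Arguments.
Unset Strict Implicit.
Unset Printing Implicit Defensive.

(** * Entries and the maximum norm of matrices *)

Lemma ler_norm_entry (R : realType) p q (A : 'M[R]_(p, q)) i j :
  `|A i j| <= `|A|.
Proof.
by rewrite [leRHS]/Num.norm/= mx_normrE; apply/bigmax_geP; right; exists (i, j).
Qed.

Lemma mx_norm_leP (R : realType) p q (A : 'M[R]_(p, q)) (c : R) : 0 <= c ->
  reflect (forall i j, `|A i j| <= c) (`|A| <= c).
Proof.
move=> c0; apply: (iffP idP) => [Ac i j|Ac].
  exact: le_trans (ler_norm_entry A i j) Ac.
by rewrite [leLHS]/Num.norm/= mx_normrE; apply/bigmax_leP; split.
Qed.

(** * Lipschitz functions near a point, and their algebra *)

Section LipschitzAt.
Context {R : realType} {V : normedModType R}.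
Implicit Types (W : normedModType R) (a : V) (h : V -> R).

(** Both points vary near [a], so this is Lipschitz continuity on some neighbourhood of [a],
    stronger than a comparison with [h a] alone. Phrasing it with a filter lets neighbourhoods be
    intersected silently. *)
Definition lipschitz_at {W} (h : V -> W) a : Prop :=
  exists M : R, \forall p \near (a, a), `|h p.1 - h p.2| <= M * `|p.1 - p.2|.

Lemma near_diag (P : V -> Prop) a :
  (\forall x \near a, P x) -> \forall p \near (a, a), P p.1 /\ P p.2.
Proof. by move=> Px0; exists (P, P). Qed.

Lemma near_diag_fst (P : V * V -> Prop) a :
  (\forall p \near (a, a), P p) -> \forall x \near a, P (x, a).
Proof.
move=> [[A B] /= [Ax0 Bx0] sub]; near=> x; apply: sub; split => /=.
  by near: x.
exact: nbhs_singleton Bx0.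
Unshelve. all: by end_near. Qed.

Lemma lipschitz_at_gt0 {W} (h : V -> W) a : lipschitz_at h a ->
  exists2 M : R, 0 < M &
    \forall p \near (a, a), `|h p.1 - h p.2| <= M * `|p.1 - p.2|.
Proof.
move=> [M hM]; exists (`|M| + 1); first by rewrite ltr_wpDl.
apply: filterS hM => p /le_trans; apply.
by rewrite ler_wpM2r// (le_trans (ler_norm M))// lerDl.
Qed.

Lemma near_eq_lipschitz_at {W} (h k : V -> W) a :
  (\forall x \near a, h x = k x) -> lipschitz_at h a -> lipschitz_at k a.
Proof.
move=> /near_diag hk [M hM]; exists M; near=> p.
have [<- <-] : h p.1 = k p.1 /\ h p.2 = k p.2 by near: p.
by near: p.
Unshelve. all: by end_near. Qed.

Lemma lipschitz_at_continuous {W} (h : V -> W) a :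
  lipschitz_at h a -> h @ a --> h a.
Proof.
move=> /lipschitz_at_gt0[M M0 /near_diag_fst hM].
apply/cvgrPdist_lt => e e0; near=> x.
rewrite distrC; have /le_lt_trans : `|h x - h a| <= M * `|x - a| by near: x.
apply; rewrite -ltr_pdivlMl// distrC; near: x.
by apply: (@cvgr_dist_lt _ _ _ _ _ idfun) => //; rewrite mulr_gt0 ?invr_gt0.
Unshelve. all: by end_near. Qed.

Lemma lipschitz_at_bounded {W} (h : V -> W) a :
  lipschitz_at h a -> \forall x \near a, `|h x| <= `|h a| + 1.
Proof.
move=> /lipschitz_at_continuous hc; near=> x.
have : `|h a - h x| < 1 by near: x; apply: cvgr_dist_lt.
rewrite distrC => /ltW xa; rewrite -(subrK (h a) (h x)) addrC.
by rewrite (le_trans (ler_normD _ _))// lerD2l.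
Unshelve. all: by end_near. Qed.

Lemma lipschitz_at_cst (c : R) a : lipschitz_at (fun=> c) a.
Proof.
exists 0; near=> p; by rewrite subrr normr0 mul0r lexx.
Unshelve. all: by end_near. Qed.

Lemma lipschitz_atD h k a : lipschitz_at h a -> lipschitz_at k a ->
  lipschitz_at (fun x => h x + k x) a.
Proof.
move=> [M hM] [N kN]; exists (M + N); near=> p.
have hp : `|h p.1 - h p.2| <= M * `|p.1 - p.2| by near: p.
have kp : `|k p.1 - k p.2| <= N * `|p.1 - p.2| by near: p.
rewrite opprD addrACA mulrDl; exact: le_trans (ler_normD _ _) (lerD hp kp).
Unshelve. all: by end_near. Qed.

Lemma lipschitz_atM h k a : lipschitz_at h a -> lipschitz_at k a ->
  lipschitz_at (fun x => h x * k x) a.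
Proof.
move=> hl kl.
have /near_diag hb := lipschitz_at_bounded hl.
have /near_diag kb := lipschitz_at_bounded kl.
move/lipschitz_at_gt0 : hl => [M M0 hM]; move/lipschitz_at_gt0: kl => [N N0 kN].
exists ((`|h a| + 1) * N + M * (`|k a| + 1)).
near=> p.
have hp : `|h p.1 - h p.2| <= M * `|p.1 - p.2| by near: p.
have kp : `|k p.1 - k p.2| <= N * `|p.1 - p.2| by near: p.
have [h1 h2] : `|h p.1| <= `|h a| + 1 /\ `|h p.2| <= `|h a| + 1 by near: p.
have [k1 k2] : `|k p.1| <= `|k a| + 1 /\ `|k p.2| <= `|k a| + 1 by near: p.
(* The product rule for differences; each difference is multiplied by a factor that is bounded near
   [a]. *)
have -> : h p.1 * k p.1 - h p.2 * k p.2 =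
  h p.1 * (k p.1 - k p.2) + (h p.1 - h p.2) * k p.2 by ring.
rewrite (le_trans (ler_normD _ _))// !normrM mulrDl lerD//.
  by rewrite -mulrA; exact: ler_pM.
by rewrite mulrAC; apply: ler_pM.
Unshelve. all: by end_near. Qed.

Lemma lipschitz_atN h a :
  lipschitz_at h a -> lipschitz_at (fun x => - h x) a.
Proof.
by move=> [M hM]; exists M; apply: filterS hM => p; rewrite -opprD normrN.
Qed.

Lemma lipschitz_atB h k a : lipschitz_at h a -> lipschitz_at k a ->
  lipschitz_at (fun x => h x - k x) a.
Proof. by move=> hl /lipschitz_atN; exact: lipschitz_atD. Qed.

Lemma lipschitz_at_sum (I : Type) (s : seq I) (P : pred I) (h : I -> V -> R) a :
  (forall i, P i -> lipschitz_at (h i) a) ->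
  lipschitz_at (fun x => \sum_(i <- s | P i) h i x) a.
Proof.
move=> hl; elim: s => [|i s IHs].
  under [X in lipschitz_at X _]eq_fun do rewrite big_nil.
  exact: lipschitz_at_cst.
have [Pi|/negbTE Pi] := boolP (P i).
  under [X in lipschitz_at X _]eq_fun do rewrite big_cons Pi.
  exact: lipschitz_atD (hl i Pi) IHs.
by under [X in lipschitz_at X _]eq_fun do rewrite big_cons Pi.
Qed.

Lemma lipschitz_at_prod (I : Type) (s : seq I) (P : pred I) (h : I -> V -> R) a :
  (forall i, P i -> lipschitz_at (h i) a) ->
  lipschitz_at (fun x => \prod_(i <- s | P i) h i x) a.
Proof.
move=> hl; elim: s => [|i s IHs].
  under [X in lipschitz_at X _]eq_fun do rewrite big_nil.
  exact: lipschitz_at_cst.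
have [Pi|/negbTE Pi] := boolP (P i).
  under [X in lipschitz_at X _]eq_fun do rewrite big_cons Pi.
  exact: lipschitz_atM (hl i Pi) IHs.
by under [X in lipschitz_at X _]eq_fun do rewrite big_cons Pi.
Qed.

(** By continuity [h] stays at least [|h a| / 2] in absolute value near [a], which bounds the
    denominator in [1/s - 1/t = (t - s)/(s t)]. *)
Lemma lipschitz_atV h a : h a != 0 ->
  lipschitz_at h a -> lipschitz_at (fun x => (h x)^-1) a.
Proof.
move=> h0 hl.
have : \forall x \near a, `|h a| / 2 <= `|h x|.
  have e0 : 0 < `|h a| / 2 by rewrite divr_gt0// normr_gt0.
  near=> x.
  have : `|h a - h x| < `|h a| / 2.
    by near: x; apply: cvgr_dist_lt => //; exact: lipschitz_at_continuous.
  have := ler_normD (h a - h x) (h x); rewrite subrK; lra.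
move=> /near_diag hb.
move/lipschitz_at_gt0 : hl => [M M0 hM].
set c := `|h a| / 2 in hb.
have c0 : 0 < c by rewrite divr_gt0// normr_gt0.
exists (c^-1 * c^-1 * M); near=> p.
have hp : `|h p.1 - h p.2| <= M * `|p.1 - p.2| by near: p.
have [h1 h2] : c <= `|h p.1| /\ c <= `|h p.2| by near: p.
have h1n0 : h p.1 != 0 by rewrite -normr_gt0 (lt_le_trans c0).
have h2n0 : h p.2 != 0 by rewrite -normr_gt0 (lt_le_trans c0).
have -> : (h p.1)^-1 - (h p.2)^-1 =
    (h p.1)^-1 * (h p.2)^-1 * (h p.2 - h p.1).
  by field; apply/andP.
rewrite !normrM !normfV [`|h p.2 - _|]distrC -!mulrA.
by do 2!(apply: ler_pM => //;
  rewrite ?mulr_ge0// ?lef_pV2 ?posrE// ?(lt_le_trans c0)//).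
Unshelve. all: by end_near. Qed.

Lemma lipschitz_at_mxP p q (F : V -> 'M[R]_(p, q)) a :
  lipschitz_at F a <-> forall i j, lipschitz_at (fun x => F x i j) a.
Proof.
split=> [[M FM] i j|].
  exists M; apply: filterS FM => z /(le_trans _); apply.
  by have := ler_norm_entry (F z.1 - F z.2) i j; rewrite !mxE.
move=> Fl.
have /choice[M FM] : forall ij, exists M : R, 0 < M /\ \forall p \near (a, a),
    `|F p.1 ij.1 ij.2 - F p.2 ij.1 ij.2| <= M * `|p.1 - p.2|.
  move=> ij; have [M M0 FM] := lipschitz_at_gt0 (Fl ij.1 ij.2).
  by exists M.
(* The sum of the positive entrywise constants dominates each of them, hence serves for the maximum
   norm. *)
exists (\sum_ij M ij).
have FMij := filter_forall _ (fun ij => (FM ij).2).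
near=> z.
have Fz : forall ij, `|F z.1 ij.1 ij.2 - F z.2 ij.1 ij.2| <= M ij * `|z.1 - z.2|.
  by near: z; exact: FMij.
apply/mx_norm_leP => [|i j].
  by rewrite mulr_ge0// sumr_ge0// => ij _; exact/ltW/(FM ij).1.
rewrite !mxE (le_trans (Fz (i, j)))// ler_wpM2r//.
by rewrite (bigD1 (i, j))//= lerDl sumr_ge0// => kl _; exact/ltW/(FM kl).1.
Unshelve. all: by end_near. Qed.

(** By the Leibniz formula the determinant is a polynomial in the entries. *)
Lemma lipschitz_at_det p (F : V -> 'M[R]_p) a :
  (forall i j, lipschitz_at (fun x => F x i j) a) ->
  lipschitz_at (fun x => \det (F x)) a.
Proof.
move=> Fl; apply: lipschitz_at_sum => s _; apply: lipschitz_atM.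
  exact: lipschitz_at_cst.
by apply: lipschitz_at_prod => i _; exact: Fl.
Qed.

(** Cramer's rule: near [a] the inverse is the adjugate divided by a nonvanishing determinant, and
    cofactors are signed determinants. *)
Lemma lipschitz_at_invmx p (F : V -> 'M[R]_p) a :
  (\forall x \near a, F x \in unitmx) ->
  (forall i j, lipschitz_at (fun x => F x i j) a) ->
  forall i j, lipschitz_at (fun x => invmx (F x) i j) a.
Proof.
move=> Fu Fl i j.
apply: (@near_eq_lipschitz_at _
    (fun x => (\det (F x))^-1 * cofactor (F x) j i)).
  by apply: filterS Fu => x Fx; rewrite /invmx Fx !mxE.
apply: lipschitz_atM.
  apply: lipschitz_atV (lipschitz_at_det Fl).
  by move: (nbhs_singleton Fu); rewrite unitmxE unitfE.
apply: lipschitz_atM (lipschitz_at_cst _ _) _.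
apply: lipschitz_at_det => k l.
by under [X in lipschitz_at X _]eq_fun do rewrite !mxE; exact: Fl.
Qed.

Lemma lipschitz_at_mulmx p q s (F : V -> 'M[R]_(p, q)) (H : V -> 'M[R]_(q, s)) a :
  (forall i j, lipschitz_at (fun x => F x i j) a) ->
  (forall i j, lipschitz_at (fun x => H x i j) a) ->
  forall i j, lipschitz_at (fun x => (F x *m H x) i j) a.
Proof.
move=> Fl Hl i j; under [X in lipschitz_at X _]eq_fun do rewrite mxE.
by apply: lipschitz_at_sum => k _; exact: lipschitz_atM.
Qed.

End LipschitzAt.

Lemma lipschitz_at_entry (R : realType) p q i j (A : 'M[R]_(p, q)) :
  lipschitz_at (fun B : 'M[R]_(p, q) => B i j) A.
Proof.
exists 1; near=> z; rewrite mul1r.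
by have := ler_norm_entry (z.1 - z.2) i j; rewrite !mxE.
Unshelve. all: by end_near. Qed.

(** * The mean value theorem and Lipschitz continuity of C^1 functions *)

Section MeanValue.
Context {R : realType} {n : nat}.
Implicit Types (h : 'cV[R]_n -> R) (x v : 'cV[R]_n).

Lemma derive_partial h x v : differentiable h x ->
  'D_v h x = \sum_j v j 0 * partial j h x.
Proof.
move=> hx; rewrite deriveE//.
rewrite {1}(_ : v = \sum_j v j 0 *: delta_mx j 0).
  by rewrite linear_sum; apply: eq_bigr => j _; rewrite linearZ/= /partial deriveE.
apply/matrixP => i j; rewrite summxE (bigD1 i)//= big1 => [|k ki].
  by rewrite !mxE (ord1 j) !eqxx mulr1 addr0.
by rewrite !mxE eq_sym (negbTE ki) mulr0.
Qed.

(** The difference quotient of the restriction to the line is literally the quotient that defines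
    the directional derivative. *)
Lemma is_derive_line h x v t : differentiable h (x + t *: v) ->
  is_derive t 1 (fun s : R => h (x + s *: v)) ('D_v h (x + t *: v)).
Proof.
move=> hx.
have E : (fun e : R => e^-1 *: (((fun s : R => h (x + s *: v)) \o shift t) (e *: 1)
             - h (x + t *: v))) =
         (fun e : R => e^-1 *: ((h \o shift (x + t *: v)) (e *: v) - h (x + t *: v))).
  apply/funext => e /=; congr (_ *: (h _ - _)).
  by rewrite [e *: 1]mulr1 scalerDl addrCA.
apply: DeriveDef; last by rewrite /derive E.
by rewrite /derivable E; exact: diff_derivable.
Qed.

Lemma mean_value_partial h x y : (forall z, differentiable h z) ->
  exists2 t : R, t \in `[0, 1] &
    h x - h y = \sum_j (x - y) j 0 * partial j h (y + t *: (x - y)).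
Proof.
move=> hd.
have hder (t : R) := is_derive_line (hd (y + t *: (x - y))).
have [|t t01] := MVT_segment (@ler01 R) (fun t _ => hder t).
  by apply: derivable_within_continuous => t _; case: (hder t).
rewrite scale1r scale0r addr0 [y + (x - y)]addrC subrK subr0 mulr1 => ->.
by exists t => //; exact: derive_partial.
Qed.

(** Continuous partial derivatives are bounded on a small ball around [x]; the ball is convex, so
    the intermediate point of the mean value theorem stays inside it. *)
Lemma C1_lipschitz_at h x : Ck 1 h -> lipschitz_at h x.
Proof.
move=> [hd hc].
have hb j : \forall z \near x, `|partial j h z| <= `|partial j h x| + 1.
  near=> z.
  have : `|partial j h x - partial j h z| < 1.
    by near: z; apply: cvgr_dist_lt => //; exact: hc.
  have := ler_normB (partial j h x) (partial j h x - partial j h z).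
  rewrite subKr; lra.
have /nbhs_ballP[e /= e0 he] :
    nbhs x [set z | forall j, `|partial j h z| <= `|partial j h x| + 1].
  exact: filter_forall hb.
have : \forall z \near x, ball x e z by exact: nbhsx_ballx.
move=> /near_diag xe.
exists (\sum_j (`|partial j h x| + 1)); near=> p.
have [] : ball x e p.1 /\ ball x e p.2 by near: p.
move: (p.1) (p.2) => a b; rewrite -!ball_normE/= => xa xb.
have [t] := mean_value_partial a b hd.
rewrite in_itv/= => /andP[t0 t1] ->.
rewrite (le_trans (ler_norm_sum _ _ _))// mulr_suml ler_sum// => j _.
rewrite normrM mulrC ler_pM ?ler_norm_entry//.
apply: he; rewrite -ball_normE/=.
have -> : x - (b + t *: (a - b)) = t *: (x - a) + (1 - t) *: (x - b).
  by apply/matrixP => k l; rewrite !mxE; ring.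
rewrite (le_lt_trans (ler_normD _ _))// !normrZ !ger0_norm ?subr_ge0//.
(* The strict inequality below comes from the summand with factor [t], so [t = 0] is treated
   apart. *)
have [->|tn0] := eqVneq t 0; first by rewrite mul0r add0r subr0 mul1r.
have tgt0 : 0 < t by rewrite lt_def tn0.
have : t * `|x - a| < t * e by rewrite ltr_pM2l.
have : (1 - t) * `|x - b| <= (1 - t) * e by rewrite ler_wpM2l ?subr_ge0// ltW.
lra.
Unshelve. all: by end_near. Qed.

End MeanValue.

(** * Closure properties of C^k functions *)

Section CkTheory.
Context {R : realType} {n : nat}.
Implicit Types (h l : 'cV[R]_n -> R) (x : 'cV[R]_n).

Lemma CkW k h : Ck k.+1 h -> Ck k h.
Proof.
elim: k h => [h [hd _] x|k IHk h [hd hp]]; first exact: differentiable_continuous.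
by split=> // j; exact: IHk.
Qed.

Lemma Ck_le k k' h : (k <= k')%N -> Ck k' h -> Ck k h.
Proof.
by move=> /subnKC <-; elim: (k' - k)%N => [|d IHd]; rewrite ?addn0// addnS => /CkW.
Qed.

Lemma Ck_cst k (c : R) : Ck k (fun _ : 'cV[R]_n => c).
Proof.
elim: k c => [|k IHk] c; first exact: cst_continuous.
split=> [x|j]; first exact: differentiable_cst.
rewrite (_ : partial j _ = fun=> 0) //.
by apply/funext => x; rewrite /partial derive_cst.
Qed.

Lemma CkD k h l : Ck k h -> Ck k l -> Ck k (fun x => h x + l x).
Proof.
elim: k h l => [|k IHk] h l; first by move=> hc lc x; exact: (cvgD (hc x) (lc x)).
move=> [hd hp] [ld lp]; split=> [x|j]; first exact: differentiableD.
rewrite (_ : partial j _ = fun x => partial j h x + partial j l x).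
  by apply: IHk; [exact: hp|exact: lp].
by apply/funext => x; rewrite /partial -deriveD//; exact: diff_derivable.
Qed.

Lemma CkM k h l : Ck k h -> Ck k l -> Ck k (fun x => h x * l x).
Proof.
elim: k h l => [|k IHk] h l; first by move=> hc lc x; exact: (cvgM (hc x) (lc x)).
move=> hk lk; have [hd hp] := hk; have [ld lp] := lk.
split=> [x|j]; first exact: differentiableM.
rewrite (_ : partial j _ = fun x => h x * partial j l x + l x * partial j h x).
  by apply: CkD; apply: IHk; first [exact: hp|exact: lp|exact: CkW].
by apply/funext => x; rewrite /partial -deriveM//; exact: diff_derivable.
Qed.

Lemma Ck_sum k (I : Type) (s : seq I) (h : I -> 'cV[R]_n -> R) :
  (forall i, Ck k (h i)) -> Ck k (fun x => \sum_(i <- s) h i x).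
Proof.
move=> hk; elim: s => [|i s IHs].
  by under [X in Ck _ X]eq_fun do rewrite big_nil; exact: Ck_cst.
under [X in Ck _ X]eq_fun do rewrite big_cons; exact: CkD.
Qed.

End CkTheory.

(** * Lie derivatives: smoothness, added constants and signs *)

Section LieDerivatives.
Context {R : realType} {n m : nat}.
Variables (f : 'cV[R]_n -> 'cV[R]_n) (g : 'cV[R]_n -> 'M[R]_(n, m)).
Implicit Types (h : 'cV[R]_n -> R) (x : 'cV[R]_n).

Lemma Ck_Lf k h : Ck_mx k f -> Ck k.+1 h -> Ck k (Lf f h).
Proof.
move=> fk [_ hp].
under [X in Ck _ X]eq_fun do
  (rewrite /Lf mxE; under eq_bigr do rewrite mxE).
by apply: Ck_sum => j; apply: CkM; [exact: hp|exact: fk].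
Qed.

(** Each Lie derivative costs one order of differentiability. *)
Lemma Ck_Lf_iter k d j h : (d + j <= k)%N ->
  Ck_mx k f -> Ck k h -> Ck d (Lf_iter f j h).
Proof.
move=> + fk hk; elim: j d => [|j IHj] d djk.
  by apply: Ck_le hk; rewrite addn0 in djk.
apply: Ck_Lf; last by apply: IHj; rewrite addSnnS.
by move=> i l; apply: Ck_le (fk i l); rewrite (leq_trans _ djk)// leq_addr.
Qed.

Lemma Ck_Lg k h i : Ck_mx k g -> Ck k.+1 h -> Ck k (fun x => Lg g h x 0 i).
Proof.
move=> gk [_ hp].
under [X in Ck _ X]eq_fun do
  (rewrite /Lg mxE; under eq_bigr do rewrite mxE).
by apply: Ck_sum => j; apply: CkM; [exact: hp|exact: gk].
Qed.

(** The constant cancels already in the difference quotients. *)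
Lemma gradDc h c : grad (fun x => h x + c) = grad h.
Proof.
apply/funext => x; apply/rowP => j; rewrite !mxE /partial /derive.
by under eq_fun do rewrite /= opprD addrACA subrr addr0.
Qed.

Lemma gradN h x : differentiable h x -> grad (fun z => - h z) x = - grad h x.
Proof.
move=> hx; apply/rowP => j; rewrite !mxE /partial.
by rewrite -deriveN//; exact: diff_derivable.
Qed.

(** The first Lie derivative removes the constant; only the term of order 0 still sees it. *)
Lemma Lf_iterDc h c j : (0 < j)%N ->
  Lf_iter f j (fun x => h x + c) = Lf_iter f j h.
Proof.
by case: j => // j _; rewrite /Lf_iter !iterSr /Lf gradDc.
Qed.

Lemma Lf_iterN k h j : (j <= k)%N -> Ck_mx k f -> Ck k h ->
  Lf_iter f j (fun x => - h x) = fun x => - Lf_iter f j h x.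
Proof.
move=> + fk hk; elim: j => // j IHj jk.
rewrite [LHS]/= -/(Lf_iter f j _) IHj 1?ltnW//; apply/funext => x.
have [+ _] : Ck 1 (Lf_iter f j h) by apply: Ck_Lf_iter hk.
by move=> /(_ x) hd; rewrite /Lf gradN// mulNmx mxE.
Qed.

Lemma LgDc h c : Lg g (fun x => h x + c) = Lg g h.
Proof. by rewrite /Lg gradDc. Qed.

Lemma LgN h x : differentiable h x -> Lg g (fun z => - h z) x = - Lg g h x.
Proof. by move=> hx; rewrite /Lg gradN// mulNmx. Qed.

End LieDerivatives.

(** * Bilinear forms and positive definite matrices *)

Section PositiveDefinite.
Context {R : realType} {m : nat}.
Implicit Types (Q : 'M[R]_m) (u v w p : 'cV[R]_m).

Definition bilin Q u v : R := (u^T *m Q *m v) 0 0.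

Lemma bilinDl Q u v w : bilin Q (u + v) w = bilin Q u w + bilin Q v w.
Proof. by rewrite /bilin linearD/= !mulmxDl mxE. Qed.

Lemma bilinDr Q u v w : bilin Q w (u + v) = bilin Q w u + bilin Q w v.
Proof. by rewrite /bilin mulmxDr mxE. Qed.

Lemma bilinZl Q t u v : bilin Q (t *: u) v = t * bilin Q u v.
Proof. by rewrite /bilin linearZ/= -!scalemxAl mxE. Qed.

Lemma bilinZr Q t u v : bilin Q u (t *: v) = t * bilin Q u v.
Proof. by rewrite /bilin -!scalemxAr mxE. Qed.

Lemma bilinNl Q u v : bilin Q (- u) v = - bilin Q u v.
Proof. by rewrite -scaleN1r bilinZl mulN1r. Qed.

Lemma bilinNr Q u v : bilin Q u (- v) = - bilin Q u v.
Proof. by rewrite -scaleN1r bilinZr mulN1r. Qed.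

Lemma bilinC Q u v : Q^T = Q -> bilin Q u v = bilin Q v u.
Proof.
by move=> QT; rewrite /bilin -{1}QT -trmx_mul -{1}[v]trmxK -trmx_mul mulmxA mxE.
Qed.

Lemma bilinE Q u v : bilin Q u v = \sum_i u i 0 * (Q *m v) i 0.
Proof. by rewrite /bilin -mulmxA mxE; under eq_bigr do rewrite mxE. Qed.

Definition bilin_lin := (bilinDl, bilinDr, bilinNl, bilinNr, bilinZl, bilinZr).

Lemma sym_posdef_ge0 Q v : sym_posdef Q -> 0 <= bilin Q v v.
Proof.
move=> [_ Qp]; have [->|/Qp/ltW//] := eqVneq v 0.
by rewrite /bilin mulmx0 mxE.
Qed.

Lemma sym_posdef_eq0 Q v : sym_posdef Q -> bilin Q v v <= 0 -> v = 0.
Proof.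
move=> [_ Qp]; apply: contraTeq => /Qp; rewrite -ltNge; exact.
Qed.

Lemma sym_posdef_unitmx Q : sym_posdef Q -> Q \in unitmx.
Proof.
move=> Qp; rewrite unitmxE unitfE; apply/negP => /det0P[v vn0 vQ].
move/eqP: vn0; apply; apply: trmx_inj; rewrite trmx0.
by apply: (sym_posdef_eq0 Qp); rewrite /bilin trmxK vQ mul0mx mxE.
Qed.

(* Cauchy-Schwarz for the inner product of [Q], against the vector [Q^-1 e_i]. *)
Lemma sqr_coord_le_bilin Q v i : sym_posdef Q ->
  v i 0 ^+ 2 <= invmx Q i i * bilin Q v v.
Proof.
move=> Qp; have Qu := sym_posdef_unitmx Qp; have [QT _] := Qp.
pose w : 'cV[R]_m := invmx Q *m delta_mx i 0.
have Qw : Q *m w = delta_mx i 0 by rewrite mulmxA mulmxV// mul1mx.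
have vw (z : 'cV[R]_m) : bilin Q z w = z i 0.
  rewrite bilinE Qw (bigD1 i)//= big1 => [|j ji].
    by rewrite !mxE !eqxx mulr1 addr0.
  by rewrite !mxE (negbTE ji) mulr0.
have ww : bilin Q w w = invmx Q i i.
  rewrite vw mxE (bigD1 i)//= big1 => [|j ji].
    by rewrite !mxE !eqxx mulr1 addr0.
  by rewrite !mxE (negbTE ji) mulr0.
have w0 : 0 < bilin Q w w.
  rewrite lt_neqAle sym_posdef_ge0// andbT eq_sym; apply/eqP => w0.
  have /eqP : Q *m w = 0 by rewrite (sym_posdef_eq0 (v := w) Qp) ?mulmx0 ?w0.
  rewrite Qw => /eqP/matrixP/(_ i 0); rewrite !mxE !eqxx => /eqP.
  by rewrite oner_eq0.
(* With [a = w^T Q w], [b = v^T Q v] and [c = v_i], the form at [a v - c w] equals [a (a b - c^2)];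
   dividing by [a > 0] gives the inequality. *)
have := sym_posdef_ge0 (invmx Q i i *: v - v i 0 *: w) Qp.
rewrite !bilin_lin (bilinC w v QT) (vw v) -!ww.
set a := bilin Q w w; set b := bilin Q v v; set c := v i 0 => H.
have : 0 <= a * (a * b - c ^+ 2) by move: H; nra.
by rewrite pmulr_rge0// subr_ge0.
Qed.

End PositiveDefinite.

(** * Weighted projection onto a box *)

Section BoxProgram.
Context {R : realType} {m : nat}.
Implicit Types (Q : 'M[R]_m) (u v w p : 'cV[R]_m) (d : 'I_m -> R).

Definition box d : set 'cV[R]_m := [set v | forall i, 0 <= v i 0 <= d i].

Definition quad_cost Q p v : R := 2^-1 * bilin Q (v - p) (v - p).

Lemma box_segment d v w t : 0 <= t <= 1 -> box d v -> box d w ->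
  box d (v + t *: (w - v)).
Proof.
move=> /andP[t0 t1] dv dw i; have := dv i; have := dw i.
rewrite !mxE => /andP[w0 wd] /andP[v0 vd].
have -> : v i 0 + t * (w i 0 - v i 0) = (1 - t) * v i 0 + t * w i 0 by ring.
rewrite addr_ge0 ?mulr_ge0 ?subr_ge0//=.
have : (1 - t) * v i 0 <= (1 - t) * d i by rewrite ler_wpM2l ?subr_ge0.
have : t * w i 0 <= t * d i by rewrite ler_wpM2l.
lra.
Qed.

(** The extreme value theorem on a product of segments. It is applied to row vectors, hence the
    transpositions; continuity follows because the cost is polynomial in the entries. *)
Lemma box_minimizer_exists Q p d : (forall i, 0 <= d i) ->
  exists v, minimizer (quad_cost Q p) (box d) v.
Proof.
move=> d0.
have cK := @rV_compact R m (fun i => `[0, d i]%classic)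
  (fun i => @segment_compact R 0 (d i)).
have K0 : [set w : 'rV[R]_m | forall i, `[0, d i]%classic (w ord0 i)] !=set0.
  by exists 0 => i; rewrite mxE /= in_itv/= lexx d0.
have cont : continuous (fun w : 'rV[R]_m => quad_cost Q p w^T).
  move=> w; apply: lipschitz_at_continuous.
  apply: lipschitz_atM; first exact: lipschitz_at_cst.
  have lw i j : lipschitz_at (fun z : 'rV[R]_m => (z^T - p) i j) w.
    under [X in lipschitz_at X _]eq_fun do rewrite !mxE.
    apply: lipschitz_atB; last exact: lipschitz_at_cst.
    exact: lipschitz_at_entry.
  rewrite /bilin; apply: lipschitz_at_mulmx => // i j.
  apply: lipschitz_at_mulmx => [k l|k l]; last exact: lipschitz_at_cst.
  by under [X in lipschitz_at X _]eq_fun do rewrite mxE.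
have [w + wmin] := EVT_min_rV K0 cK (continuous_subspaceT cont).
rewrite inE/= => wK; exists w^T; split=> [i|v dv].
  by have := wK i; rewrite /= in_itv/= mxE.
have := wmin v^T; rewrite trmxK; apply; rewrite inE/= => i.
by rewrite in_itv/= mxE; exact: dv.
Qed.

(** First-order optimality: the box is convex, so if the directional derivative [b] towards [w] were
    negative, a short step towards [w] would lower the cost. *)
Lemma minimizer_variational Q p d v w : sym_posdef Q ->
  minimizer (quad_cost Q p) (box d) v -> box d w ->
  0 <= bilin Q (w - v) (v - p).
Proof.
move=> Qp [dv vmin] dw; have [QT _] := Qp.
set z := w - v; set b := bilin Q z (v - p); rewrite leNgt; apply/negP => b0.
have c0 := sym_posdef_ge0 z Qp; set c := bilin Q z z in c0.
have cb0 : 0 < c - b by lra.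
(* This step length lies in (0, 1] and satisfies [t c = - b + t b], so [2 b + t c = b (1 + t)] is
   negative and the cost drops. *)
pose t := - b / (c - b).
have t0 : 0 < t by rewrite divr_gt0// oppr_gt0.
have t1 : t <= 1 by rewrite ler_pdivrMr// mul1r; lra.
have /vmin : box d (v + t *: z) by apply: box_segment; rewrite // ltW.
have expand : bilin Q (v + t *: z - p) (v + t *: z - p) =
    bilin Q (v - p) (v - p) + 2 * t * b + t ^+ 2 * c.
  rewrite addrAC /b /c; move: (v - p) (z) => a y.
  by rewrite !bilin_lin (bilinC a y QT); ring.
have tcb : t * (c - b) = - b by rewrite divfK// gt_eqF.
rewrite /quad_cost expand => H.
have : 0 <= t * (2 * b + t * c) by lra.
rewrite pmulr_rge0//; nra.
Qed.

Lemma box_minimizer_unique Q p d v w : sym_posdef Q ->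
  minimizer (quad_cost Q p) (box d) v -> minimizer (quad_cost Q p) (box d) w ->
  v = w.
Proof.
move=> Qp vm wm.
have h1 := minimizer_variational Qp vm wm.1.
have h2 := minimizer_variational Qp wm vm.1.
apply/subr0_eq/(sym_posdef_eq0 Qp).
(* Adding the two variational inequalities cancels the center [p]. *)
have -> : bilin Q (v - w) (v - w) =
    - (bilin Q (w - v) (v - p) + bilin Q (v - w) (w - p)).
  by rewrite !bilin_lin; ring.
by rewrite oppr_le0 addr_ge0.
Qed.

Lemma box_minimizer_lipschitz_at (V : normedModType R) (a : V)
    (Q : V -> 'M[R]_m) (p : V -> 'cV[R]_m) d (v : V -> 'cV[R]_m) :
  (forall i j, lipschitz_at (fun x => Q x i j) a) ->
  (forall i j, lipschitz_at (fun x => p x i j) a) ->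
  (\forall x \near a, sym_posdef (Q x)) ->
  (\forall x \near a, minimizer (quad_cost (Q x) (p x)) (box d) (v x)) ->
  lipschitz_at v a.
Proof.
move=> Ql pl Qpos vmin.
have Qpl : lipschitz_at (fun x => Q x *m p x) a.
  by apply/lipschitz_at_mxP; exact: lipschitz_at_mulmx.
have [L L0 QL] := lipschitz_at_gt0 (iffRL (lipschitz_at_mxP _ _) Ql).
have [L' L'0 QpL] := lipschitz_at_gt0 Qpl.
have QVl : lipschitz_at (fun x => invmx (Q x)) a.
  apply/lipschitz_at_mxP; apply: lipschitz_at_invmx => //.
  by apply: filterS Qpos => x; exact: sym_posdef_unitmx.
have /near_diag QVb := lipschitz_at_bounded QVl.
set N := `|invmx (Q a)| + 1 in QVb.
pose D := \sum_i `|d i|.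
have D0 : 0 <= D by exact: sumr_ge0.
have dD w i : box d w -> `|w i 0| <= D.
  move=> /(_ i)/andP[w0 wd]; rewrite ger0_norm// (le_trans wd)// /D (bigD1 i)//=.
  by rewrite (le_trans (ler_norm _))// lerDl sumr_ge0.
pose C := m%:R * L * D + L'.
have C0 : 0 <= C by rewrite addr_ge0 ?mulr_ge0// ltW.
exists (N * (m%:R * C)).
move/near_diag : vmin => vmin; move/near_diag : Qpos => Qpos.
near=> x.
have QLx : `|Q x.1 - Q x.2| <= L * `|x.1 - x.2| by near: x.
have QpLx : `|Q x.1 *m p x.1 - Q x.2 *m p x.2| <= L' * `|x.1 - x.2| by near: x.
have [QVN _] : `|invmx (Q x.1)| <= N /\ `|invmx (Q x.2)| <= N by near: x.
have [v1 v2] : minimizer (quad_cost (Q x.1) (p x.1)) (box d) (v x.1) /\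
  minimizer (quad_cost (Q x.2) (p x.2)) (box d) (v x.2) by near: x.
have [Q1 Q2] : sym_posdef (Q x.1) /\ sym_posdef (Q x.2) by near: x.
set e := v x.1 - v x.2; set del := `|x.1 - x.2| in QLx QpLx *.
(* This is [Q x.2 *m (v x.2 - p x.2) - Q x.1 *m (v x.2 - p x.1)], the difference of the two cost
   gradients at [v x.2], regrouped so that each term is of order [del]; [v x.2] is bounded by the
   box. *)
pose s := (Q x.2 - Q x.1) *m v x.2 + (Q x.1 *m p x.1 - Q x.2 *m p x.2).
have sC i : `|s i 0| <= C * del.
  rewrite mxE (le_trans (ler_normD _ _))// /C mulrDl lerD//; last first.
    exact: le_trans (ler_norm_entry _ _ _) QpLx.
  rewrite mxE (le_trans (ler_norm_sum _ _ _))//.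
  apply: (@le_trans _ _ (\sum_(j < m) L * del * D)).
    apply: ler_sum => j _; rewrite normrM ler_pM ?dD//; last exact: v2.1.
    by rewrite (le_trans (ler_norm_entry _ _ _))// distrC.
  rewrite sumr_const card_ord -mulr_natl le_eqVlt; apply/orP; left.
  by apply/eqP; ring.
(* Each minimizer is tested against the other one, and the two inequalities are combined. *)
have Qe : bilin (Q x.1) e e <= \sum_i e i 0 * s i 0.
  have h1 := minimizer_variational Q1 v1 v2.1.
  have h2 := minimizer_variational Q2 v2 v1.1.
  have -> : \sum_i e i 0 * s i 0 = bilin (Q x.2) e (v x.2 - p x.2)
      - bilin (Q x.1) e (v x.2 - p x.1).
    rewrite !bilinE -sumrB; apply: eq_bigr => i _; rewrite -mulrBr.
    congr (_ * _); rewrite /s !mulmxBr !mulmxBl !mxE; ring.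
  have -> : bilin (Q x.1) e e = - bilin (Q x.1) (v x.2 - v x.1) (v x.1 - p x.1)
      - bilin (Q x.1) e (v x.2 - p x.1).
    by rewrite /e !bilin_lin; ring.
  by rewrite lerD2r; apply: le_trans h2; rewrite oppr_le0.
have Qe' : bilin (Q x.1) e e <= `|e| * (m%:R * C * del).
  rewrite (le_trans Qe)// (le_trans (ler_norm _))//.
  rewrite (le_trans (ler_norm_sum _ _ _))//.
  apply: (@le_trans _ _ (\sum_(j < m) `|e| * (C * del))).
    by apply: ler_sum => j _; rewrite normrM ler_pM// ler_norm_entry.
  rewrite sumr_const card_ord -mulr_natl le_eqVlt; apply/orP; left.
  by apply/eqP; ring.
have N0 : 0 <= N by exact: le_trans QVN.
have [->|en0] := eqVneq `|e| 0; first by rewrite !mulr_ge0 ?normr_ge0.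
have e0 : 0 < `|e| by rewrite lt_def en0 normr_ge0.
(* The maximum norm is attained at some entry [i], so [|e|^2 = e_i^2]. The coordinate bound then
   leaves one factor [|e|] on the right, and this factor cancels. *)
have [[i j] /= ei] := mx_norm_neq0 en0; rewrite (ord1 j) in ei.
have {}ei : `|e| = `|e i 0| by [].
rewrite -(ler_pM2l e0) {1 2}ei -expr2 real_normK ?num_real//.
rewrite (le_trans (sqr_coord_le_bilin _ _ Q1))//.
have QViN : invmx (Q x.1) i i <= N.
  exact: le_trans (ler_norm _) (le_trans (ler_norm_entry _ _ _) QVN).
rewrite (le_trans (ler_wpM2r (sym_posdef_ge0 e Q1) QViN))//.
rewrite (le_trans (ler_wpM2l N0 Qe'))//.
by rewrite mulrCA -!mulrA.
Unshelve. all: by end_near. Qed.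

End BoxProgram.

(** * Local Lipschitz continuity on a set versus at its points *)

Section LocallyLipschitz.
Context {R : realType} {V W : normedModType R}.
Implicit Types (h : V -> W) (A : set V).

Lemma locally_lipschitz_lipschitz_at h A a : open A -> A a ->
  [locally [lipschitz h x | x in A]] -> lipschitz_at h a.
Proof.
move=> oA Aa /(_ (a, a) (conj Aa Aa)) hl.
(* At the diagonal pair the condition holds for all large constants; one of them is chosen. *)
have [M hM] := @filter_ex _ (pinfty_nbhs R) _ _ hl; exists M.
have /near_diag nA : \forall x \near a, A x by exact: open_nbhs_nbhs.
near=> p.
have Ap : A p.1 /\ A p.2 by near: p.
by move: Ap; near: p; exact: hM.
Unshelve. all: by end_near. Qed.

(* [locally] also asks for a bound near the off-diagonal pairs of [A `*` A];
   there it comes from local boundedness of [h]. *)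
Lemma lipschitz_at_locally_lipschitz h A :
  (forall a, A a -> lipschitz_at h a) -> [locally [lipschitz h x | x in A]].
Proof.
move=> hl [a b] [/= Aa Ab].
suff [M hM] : exists M : R,
    \forall p \near (a, b), `|h p.1 - h p.2| <= M * `|p.1 - p.2|.
  rewrite /lipschitz_on; near=> N; apply: filterS hM => p hp _ /=.
  rewrite (le_trans hp)// ler_wpM2r//.
have [<-|ab] := eqVneq a b; first exact: hl.
have d0 : 0 < `|a - b| by rewrite normr_gt0 subr_eq0.
set d := `|a - b| in d0.
have d4 : 0 < d / 4 by rewrite divr_gt0.
(* The numerator bounds the difference of the values, and [d / 2] bounds the distance of the points
   from below, since each is within [d / 4] of its center. *)
exists ((`|h a| + 1 + (`|h b| + 1)) / (d / 2)).
have hab : \forall p \near (a, b), `|h p.1| <= `|h a| + 1 /\ `|h p.2| <= `|h b| + 1.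
  by exists ([set x | `|h x| <= `|h a| + 1], [set x | `|h x| <= `|h b| + 1]) => //;
    split; exact/lipschitz_at_bounded/hl.
have dab : \forall p \near (a, b), ball a (d / 4) p.1 /\ ball b (d / 4) p.2.
  by exists (ball a (d / 4), ball b (d / 4)) => //; split; exact: nbhsx_ballx.
near=> p.
have [ha hb] : `|h p.1| <= `|h a| + 1 /\ `|h p.2| <= `|h b| + 1 by near: p.
have [] : ball a (d / 4) p.1 /\ ball b (d / 4) p.2 by near: p.
rewrite -!ball_normE/= => pa pb.
have dp : d / 2 <= `|p.1 - p.2|.
  have := ler_distD p.1 a b; have := ler_distD p.2 p.1 b.
  rewrite (distrC p.2 b) -/d; lra.
rewrite (le_trans (ler_normB _ _))// (le_trans (lerD ha hb))// -mulrA.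
by rewrite ler_peMr ?addr_ge0// mulrC ler_pdivlMr ?divr_gt0// mul1r.
Unshelve. all: by end_near. Qed.

End LocallyLipschitz.

(** * Barrier constraints under shifts and a change of sign *)

Section BarrierConstraint.
Context {R : realType} {n m : nat}.
Variables (f : 'cV[R]_n -> 'cV[R]_n) (g : 'cV[R]_n -> 'M[R]_(n, m)).
Variables (r : nat) (r_gt0 : (0 < r)%N) (alpha : 'cV[R]_r).
Implicit Types (h : 'cV[R]_n -> R) (x : 'cV[R]_n) (u : 'cV[R]_m) (c : R).

Let alpha1 := alpha (Ordinal r_gt0) 0.

Lemma HvecE h x : (alpha^T *m Hvec f r h x) 0 0 =
  \sum_(j < r) alpha j 0 * Lf_iter f j h x.
Proof. by rewrite mxE; apply: eq_bigr => j _; rewrite !mxE. Qed.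

(** A constant survives only in the zeroth entry of [Hvec], where it is weighted by [alpha1]. This
    is the source of the constant box widths. *)
Lemma barrier_constraintDc h c x u :
  barrier_constraint f g alpha (fun z => h z + c) x u <->
  - (\sum_(j < r) alpha j 0 * Lf_iter f j h x + alpha1 * c) <=
    Lf_iter f r h x + (Lg g (Lf_iter f r.-1 h) x *m u) 0 0.
Proof.
rewrite /barrier_constraint HvecE Lf_iterDc//.
have -> : Lg g (Lf_iter f r.-1 (fun z => h z + c)) = Lg g (Lf_iter f r.-1 h).
  (* For [r = 1] the gradient inside [Lg] removes the constant; otherwise the first [Lf] does. *)
  by case: (r.-1) => [|k]; [exact: LgDc|rewrite Lf_iterDc].
have -> : \sum_(j < r) alpha j 0 * Lf_iter f j (fun z => h z + c) x =
    \sum_(j < r) alpha j 0 * Lf_iter f j h x + alpha1 * c.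
  rewrite (bigD1 (Ordinal r_gt0))//= [in RHS](bigD1 (Ordinal r_gt0))//=.
  rewrite mulrDr -!addrA; congr (_ + _); rewrite addrC; congr (_ + _).
  apply: eq_bigr => j j0; rewrite Lf_iterDc// lt0n; apply: contra j0 => /eqP j0.
  exact/eqP/val_inj.
by [].
Qed.

Lemma barrier_constraintNDc k h c x u : (r < k)%N -> Ck_mx k f -> Ck k h ->
  barrier_constraint f g alpha (fun z => c - h z) x u <->
  Lf_iter f r h x + (Lg g (Lf_iter f r.-1 h) x *m u) 0 0 <=
  - (\sum_(j < r) alpha j 0 * Lf_iter f j h x - alpha1 * c).
Proof.
move=> rk fk hk; under [X in barrier_constraint _ _ _ X]eq_fun do rewrite addrC.
have LfN j : (j <= r)%N -> Lf_iter f j (fun z => - h z) = fun z => - Lf_iter f j h z.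
  by move=> jr; apply: (Lf_iterN (leq_trans jr (ltnW rk))).
rewrite barrier_constraintDc !LfN ?leq_pred//.
have [hd _] : Ck 1 (Lf_iter f r.-1 h).
  by apply: Ck_Lf_iter fk hk; rewrite add1n prednK// ltnW.
rewrite LgN// mulNmx mxE.
rewrite (eq_bigr (fun j : 'I_r => - (alpha j 0 * Lf_iter f j h x))); last first.
  by move=> j _; rewrite LfN ?mulrN// ltnW.
rewrite sumrN; split; lra.
Qed.

End BarrierConstraint.

(** * The feasible set in box coordinates *)

Section BoxCoordinates.
Context {R : realType} {n m : nat}.
Variables (f : 'cV[R]_n -> 'cV[R]_n) (g : 'cV[R]_n -> 'M[R]_(n, m)).
Variables (y : 'cV[R]_n -> 'cV[R]_m) (r : 'I_m -> nat).
Hypothesis r_gt0 : forall i, (0 < r i)%N.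
Variables (k : nat) (r_lt_k : forall i, (r i < k)%N).
Hypotheses (f_smooth : Ck_mx k f) (g_smooth : Ck_mx k g) (y_smooth : Ck_mx k y).
Variables (ylo yhi : 'I_m -> R) (alpha : forall i, 'cV[R]_(r i)).

Let B := decoupling_matrix f g y r.
Let alpha1 i := alpha i (Ordinal (r_gt0 i)) 0.

(** The lower bound that the constraint from [h_lower] puts on the entries of [B x *m u]. *)
Definition input_offset (x : 'cV[R]_n) : 'cV[R]_m := \col_i
  (alpha1 i * ylo i - \sum_(j < r i) alpha i j 0 * Lf_iter f j (output y i) x
   - Lf_iter f (r i) (output y i) x).

(* In the coordinates [v = B(x) u - input_offset x] the feasible set does not
   depend on [x]. *)
Lemma qp_feasible_box x u : qp_feasible f g y ylo yhi alpha x u <->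
  box (fun i => alpha1 i * (yhi i - ylo i)) (B x *m u - input_offset x).
Proof.
have Bu i : (B x *m u) i 0 = (Lg g (Lf_iter f (r i).-1 (output y i)) x *m u) 0 0.
  by rewrite !mxE; apply: eq_bigr => j _; rewrite !mxE.
have P i : barrier_constraint f g (alpha i) (h_lower y ylo i) x u /\
    barrier_constraint f g (alpha i) (h_upper y yhi i) x u <->
    0 <= (B x *m u - input_offset x) i 0 <= alpha1 i * (yhi i - ylo i).
  have := barrier_constraintDc f g (r_gt0 i) (alpha i) (output y i) (- ylo i) x u.
  have := barrier_constraintNDc g (r_gt0 i) (alpha i) (yhi i) x u (r_lt_k i) f_smooth
    (y_smooth i 0).
  rewrite -/(output y i) -/(h_upper y yhi i) -/(h_lower y ylo i) -!Bu.
  move=> -> ->; rewrite [(B x *m u - _) i 0]mxE [(- input_offset x) i 0]mxE.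
  rewrite [input_offset x i 0]mxE -/(alpha1 i).
  by split=> [[? ?]|/andP[? ?]]; [apply/andP; split|split]; lra.
by split=> H i; apply/P.
Qed.

(** The entries of row [i] take [r i] derivatives of the output, so [r i < k] leaves them C^1. *)
Lemma lipschitz_at_decoupling_matrix x i j : lipschitz_at (fun z => B z i j) x.
Proof.
under [X in lipschitz_at X _]eq_fun do rewrite mxE.
apply: C1_lipschitz_at; apply: Ck_Lg => [k' l|].
  by apply: Ck_le (g_smooth k' l); exact: leq_ltn_trans (r_lt_k i).
by apply: Ck_Lf_iter f_smooth (y_smooth i 0); rewrite addSn add1n prednK.
Qed.

Lemma lipschitz_at_input_offset x i j : lipschitz_at (fun z => input_offset z i j) x.
Proof.
under [X in lipschitz_at X _]eq_fun do rewrite mxE.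
have LL l : (l <= r i)%N -> lipschitz_at (Lf_iter f l (output y i)) x.
  move=> lr; apply: C1_lipschitz_at; apply: Ck_Lf_iter f_smooth (y_smooth i 0).
  by rewrite add1n (leq_ltn_trans lr).
apply: lipschitz_atB; last exact: LL.
apply: lipschitz_atB; first exact: lipschitz_at_cst.
apply: lipschitz_at_sum => l _; apply: lipschitz_atM; first exact: lipschitz_at_cst.
by apply: LL; exact: ltnW.
Qed.

End BoxCoordinates.

(** * Change of coordinates in the cost, and the solution map *)

Lemma sym_posdef_congr (R : realType) m (A Q : 'M[R]_m) :
  A \in unitmx -> sym_posdef Q -> sym_posdef (A^T *m Q *m A).
Proof.
move=> Au [QT Qp]; split; first by rewrite !trmx_mul trmxK QT mulmxA.
move=> v vn0.
have -> : v^T *m (A^T *m Q *m A) *m v = (A *m v)^T *m Q *m (A *m v).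
  by rewrite trmx_mul !mulmxA.
by apply: Qp; apply: contra_neq vn0 => Av; rewrite -(mulKmx Au v) Av mulmx0.
Qed.

Lemma quad_cost_congr (R : realType) m (B Q : 'M[R]_m) (p c u : 'cV[R]_m) :
  B \in unitmx ->
  quad_cost ((invmx B)^T *m Q *m invmx B) (B *m p - c) (B *m u - c) = quad_cost Q p u.
Proof.
move=> Bu; rewrite /quad_cost /bilin.
have -> : B *m u - c - (B *m p - c) = B *m (u - p).
  by rewrite mulmxBr opprB addrA subrK.
by rewrite -!mulmxA mulKmx// !mulmxA -trmx_mul mulKmx.
Qed.

Unset Implicit Arguments.

Theorem lemma3 (R : realType) (n m : nat)
  (f : 'cV[R]_n -> 'cV[R]_n) (g : 'cV[R]_n -> 'M[R]_(n, m))
  (y : 'cV[R]_n -> 'cV[R]_m)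
  (r : 'I_m -> nat) (r_gt0 : forall i, (0 < r i)%N)
  (k : nat) (r_lt_k : forall i, (r i < k)%N)
  (f_smooth : Ck_mx k f) (g_smooth : Ck_mx k g) (y_smooth : Ck_mx k y)
  (ylo yhi : 'I_m -> R)
  (alpha : forall i, 'cV[R]_(r i)) (nu : forall i, (r i).-tuple R)
  (alpha_nu : forall i,
     'X^(r i) + \sum_(j < r i) alpha i j 0 *: 'X^j
       = \prod_(j < r i) ('X - (tnth (nu i) j)%:P) :> {poly R})
  (nu_lt0 : forall i (j : 'I_(r i)), tnth (nu i) j < 0)
  (E : set 'cV[R]_n) (E_open : open E)
  (S_sub_E : safe_set f y ylo yhi nu `<=` E)
  (y_reldeg : vector_relative_degree_on f g y r E)
  (alpha1_gt0 : forall i, 0 < alpha i (Ordinal (r_gt0 i)) 0)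
  (ylo_lt_yhi : forall i, ylo i < yhi i)
  (kd : 'cV[R]_n -> 'cV[R]_m) (G : 'cV[R]_n -> 'M[R]_m)
  (kd_lip : [locally [lipschitz kd x | x in [set: 'cV[R]_n]]])
  (G_lip : [locally [lipschitz G x | x in [set: 'cV[R]_n]]])
  (G_spd : forall x, sym_posdef (G x)) :
  exists ustar : 'cV[R]_n -> 'cV[R]_m,
    (forall x, E x ->
       minimizer (qp_cost kd G x) (qp_feasible f g y ylo yhi alpha x)
         (ustar x) /\
       forall u,
         minimizer (qp_cost kd G x) (qp_feasible f g y ylo yhi alpha x) u ->
         u = ustar x) /\
    [locally [lipschitz ustar x | x in E]].
Proof.
set B := decoupling_matrix f g y r.
set b := input_offset f y r_gt0 ylo alpha.
pose d i := alpha i (Ordinal (r_gt0 i)) 0 * (yhi i - ylo i).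
have Bu x : E x -> B x \in unitmx by move=> /y_reldeg[].
(* Weight and center of the cost after the substitution [v = B x *m u - b x]. *)
pose Q x := (invmx (B x))^T *m G x *m invmx (B x).
pose p x := B x *m kd x - b x.
have Qpos x : E x -> sym_posdef (Q x).
  by move=> Ex; apply: sym_posdef_congr (G_spd x); rewrite unitmx_inv Bu.
have minE x u : E x ->
    minimizer (qp_cost kd G x) (qp_feasible f g y ylo yhi alpha x) u <->
    minimizer (quad_cost (Q x) (p x)) (box d) (B x *m u - b x).
  move=> Ex.
  have feasE :=
    qp_feasible_box g r_gt0 r_lt_k f_smooth y_smooth ylo yhi alpha x.
  have costE w : quad_cost (Q x) (p x) (B x *m w - b x) = qp_cost kd G x w.
    exact: quad_cost_congr (Bu x Ex).
  split=> -[uK umin]; split=> [|w wK]; [exact/feasE| |exact/feasE|].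
    (* Every box point is the image of an input, so minimality over inputs gives minimality over the
       whole box. *)
    have wE : w = B x *m (invmx (B x) *m (w + b x)) - b x.
      by rewrite mulKVmx ?Bu// addrK.
    by rewrite wE !costE; apply/umin/feasE; rewrite -/B -/b -wE.
  by rewrite -!costE; apply/umin/feasE.
have d_ge0 i : 0 <= d i by rewrite mulr_ge0 ?subr_ge0// ltW.
(* The box program has a minimizer at every [x], so [v] is chosen on the whole space; it is pulled
   back to inputs below, and only its values on [E] matter. *)
have /choice[v vmin] x := box_minimizer_exists (Q x) (p x) d_ge0.
have Bvb x : E x -> B x *m (invmx (B x) *m (v x + b x)) - b x = v x.
  by move=> Ex; rewrite mulKVmx ?Bu// addrK.
exists (fun x => invmx (B x) *m (v x + b x)); split=> [x Ex|].
  split=> [|u /(minE x u Ex) um]; first by apply/minE => //; rewrite Bvb.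
  rewrite -(box_minimizer_unique (Qpos x Ex) um (vmin x)).
  by rewrite subrK mulKmx ?Bu.
(* The solution is assembled from [invmx (B x)], [v] and [b], so it suffices that each of them is
   Lipschitz near every point of [E]; openness of [E] makes [B] invertible nearby. *)
apply: lipschitz_at_locally_lipschitz => a Ea; apply/lipschitz_at_mxP.
have nE : \forall x \near a, E x by exact: open_nbhs_nbhs.
have Bl i j : lipschitz_at (fun x => B x i j) a.
  exact: (lipschitz_at_decoupling_matrix r_gt0 r_lt_k).
have bl i j : lipschitz_at (fun x => b x i j) a.
  exact: (lipschitz_at_input_offset r_gt0 r_lt_k).
have Il : forall i j, lipschitz_at (fun x => invmx (B x) i j) a.
  by apply: lipschitz_at_invmx => //; exact: filterS Bu nE.
have kl : forall i j, lipschitz_at (fun x => kd x i j) a.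
  apply/lipschitz_at_mxP.
  by apply: locally_lipschitz_lipschitz_at kd_lip => //; exact: openT.
have Gl : forall i j, lipschitz_at (fun x => G x i j) a.
  apply/lipschitz_at_mxP.
  by apply: locally_lipschitz_lipschitz_at G_lip => //; exact: openT.
have vl : forall i j, lipschitz_at (fun x => v x i j) a.
  apply/lipschitz_at_mxP; apply: (@box_minimizer_lipschitz_at _ _ _ _ Q p d).
  - apply: (lipschitz_at_mulmx _ Il); apply: (lipschitz_at_mulmx _ Gl) => i j.
    under [X in lipschitz_at X _]eq_fun do rewrite mxE.
    exact: Il.
  - move=> i j.
    under [X in lipschitz_at X _]eq_fun do rewrite mxE [X in _ + X]mxE.
    exact: (lipschitz_atB (lipschitz_at_mulmx Bl kl i j) (bl i j)).
  - exact: filterS Qpos nE.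
  - by apply: filterS nE => x _; exact: vmin.
apply: (lipschitz_at_mulmx Il) => i j.
under [X in lipschitz_at X _]eq_fun do rewrite mxE.
exact: (lipschitz_atD (vl i j) (bl i j)).
Qed.
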